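(* Let $n\ge1$, $\lambda=(\lambda_1,\dots,\lambda_n)\in\overline{\mathbb{B}_n}$, and let $D:A_n\to\mathbb{C}$ be a nontrivial (i.e. nonzero) point derivation at $\lambda$ which factors through $A_{m,\mathfrak{C}}$, where $m$ is the number of indices $i$ with $\lambda_i\neq0$. Then $|\lambda|<1$. Further, $D$ factors continuously through $A_{m,\mathfrak{C}}$.
   Context: $A_n$ is the norm closed algebra $\mathcal{T}^{+}(B_n)$ of the directed graph $B_n$ with one vertex and $n$ edges, i.e. the norm closed unital algebra generated by the left creation operators $L_1,\dots,L_n$ (left multiplication by the $n$ letters) on $\ell^2$ of the free monoid on $n$ letters ($A_0=\mathbb{C}$). $\overline{\mathbb{B}_n}$ is the closed unit ball of $\mathbb{C}^n$ and $|\lambda|$ the Euclidean norm. For $\lambda\in\overline{\mathbb{B}_n}$, $\pi_\lambda$ is the multiplicative linear functional on $A_n$ determined by $\pi_\lambda(L_i)=\lambda_i$. $\mathfrak{C}_m$ (also $\mathfrak{C}$) is the (norm closed, two-sided) commutator ideal of $A_m$, and $A_{m,\mathfrak{C}}:=A_m/\mathfrak{C}_m$. A point derivation at $\lambda$ (derivation at $\pi_\lambda$) is a continuous linear map $D:A_n\to\mathbb{C}$ with $D(ab)=D(a)\pi_\lambda(b)+\pi_\lambda(a)D(b)$. Let $\iota:A_n\to A_{m,\mathfrak{C}}$ be the composition of the completely contractive homomorphism $\Omega:A_n\to A_m$, which sends the generators $L_i$ with $\lambda_i\ne0$ (in order) to the generators of $A_m$ and the other $L_i$ to $0$, with the quotient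 map $A_m\to A_{m,\mathfrak{C}}$; $\pi_\lambda$ factors as $\tilde\pi\circ\iota$ with $\tilde\pi$ the functional on $A_{m,\mathfrak{C}}$ given by evaluation at the nonzero coordinates of $\lambda$. $D$ factors through $A_{m,\mathfrak{C}}$ if there is a linear map $\tilde D:A_{m,\mathfrak{C}}\to\mathbb{C}$ with $\tilde D(xy)=\tilde D(x)\tilde\pi(y)+\tilde\pi(x)\tilde D(y)$ and $D=\tilde D\circ\iota$; it factors continuously if $\tilde D$ can be taken continuous. *)

(* Defs.v *)
From HB Require Import structures.
From mathcomp Require Import all_boot all_order all_algebra.
From mathcomp Require Import all_classical all_reals all_analysis.
From mathcomp Require Import complex ring lra.

Set Implicit Arguments.
Unset Strict Implicit.
Unset Printing Implicit Defensive.

Import Order.TTheory GRing.Theory Num.Theory.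
Import ComplexField.Normc.
Import numFieldNormedType.Exports.

Local Open Scope classical_set_scope.
Local Open Scope ring_scope.

(* The norm of a normed module over R[i] takes its values in R[i]; norms are
   therefore first defined with values in R ([normc] is the real-valued
   modulus) and then cast with [%:C]. *)

Section SquareSums.
Variables (R : realType) (I : choiceType).
Implicit Types (f g : I -> R[i]) (a : I -> \bar R).

Definition sqsum f : \bar R := \esum_(w in [set: I]) (normc (f w) ^+ 2)%:E.

Lemma normc_abs (z : R[i]) : `|z| = (normc z)%:C%C.
Proof. by rewrite normc_def; case: z. Qed.

Lemma normc_ge0 (z : R[i]) : 0 <= normc z.
Proof. by case: z => a b; exact: sqrtr_ge0. Qed.

Lemma esum_scale_le (c : R) a : 0 <= c -> (forall i, (0 <= a i)%E) ->
  (\esum_(i in [set: I]) (c%:E * a i) <= c%:E * \esum_(i in [set: I]) a i)%E.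
Proof.
move=> c0 a0; apply: ge_ereal_sup => _ [X [finX XI]] <-.
rewrite -ge0_mule_fsumr//; apply: lee_pmul; rewrite ?lee_fin//.
  by apply: fsume_ge0.
by apply: esum_ge; exists X.
Qed.

Lemma sqsum_ge0 f : (0 <= sqsum f)%E.
Proof. by apply: esum_ge0 => w _; rewrite lee_fin sqr_ge0. Qed.

Lemma sqsum_ge f w : ((normc (f w) ^+ 2)%:E <= sqsum f)%E.
Proof.
apply: esum_ge; exists [set w]; last by rewrite fsbig_set1.
by split=> //; exact: finite_set1.
Qed.

Lemma sqsum_comb (s t : R) (f g h : I -> R[i]) : 0 <= s -> 0 <= t ->
  (forall w, normc (h w) ^+ 2 <= s * normc (f w) ^+ 2 + t * normc (g w) ^+ 2) ->
  (sqsum h <= s%:E * sqsum f + t%:E * sqsum g)%E.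
Proof.
move=> s0 t0 H.
apply: (@le_trans _ _ (\esum_(w in [set: I])
   (s%:E * (normc (f w) ^+ 2)%:E + t%:E * (normc (g w) ^+ 2)%:E))%E).
  by apply: le_esum => w _; rewrite lee_fin.
rewrite esumD; last 2 first.
- by move=> w _; rewrite mule_ge0 ?lee_fin// sqr_ge0.
- by move=> w _; rewrite mule_ge0 ?lee_fin// sqr_ge0.
by apply: leeD; apply: esum_scale_le => // w; rewrite lee_fin sqr_ge0.
Qed.

Lemma sqsumD_le (t : R) f g : 0 < t ->
  (sqsum (fun w => f w + g w)%R <=
     (1 + t)%:E * sqsum f + (1 + t^-1)%:E * sqsum g)%E.
Proof.
move=> t0; have ti0 : 0 < t^-1 by rewrite invr_gt0.
apply: sqsum_comb; [by rewrite addr_ge0// ltW|by rewrite addr_ge0// ltW|].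
move=> w /=; set a := normc (f w); set b := normc (g w).
apply: (@le_trans _ _ ((a + b) ^+ 2)).
  by rewrite lerXn2r ?nnegrE ?addr_ge0 ?normc_ge0// le_normcD.
have -> : (1 + t) * a ^+ 2 + (1 + t^-1) * b ^+ 2 =
   (a + b) ^+ 2 + t * (a - t^-1 * b) ^+ 2 by field; rewrite gt_eqF.
by rewrite lerDl mulr_ge0 ?sqr_ge0// ltW.
Qed.

Lemma sqsumZ_le (c : R[i]) f :
  (sqsum (fun w => (c * f w)%R) <= (normc c ^+ 2)%:E * sqsum f)%E.
Proof.
apply: le_trans (esum_scale_le _ _) => //; rewrite ?sqr_ge0//.
  by apply: le_esum => w _; rewrite normcM exprMn.
by move=> w; rewrite lee_fin sqr_ge0.
Qed.

End SquareSums.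

Definition square_summable (R : realType) (n : nat) :
    {pred seq 'I_n -> R[i]} :=
  fun f => `[< (sqsum f < +oo)%E >].

Lemma square_summableP (R : realType) n (f : seq 'I_n -> R[i]) :
  reflect (sqsum f < +oo)%E (f \in @square_summable R n).
Proof. exact: asboolP. Qed.

Lemma square_summable_submod (R : realType) n :
  GRing.submod_closed (@square_summable R n).
Proof.
split.
  apply/asboolP; rewrite /sqsum esum1// => w _.
  by rewrite (_ : normc _ = 0) ?expr0n//; exact: normc0.
move=> c f g /asboolP Hf /asboolP Hg; apply/asboolP.
apply: le_lt_trans (@sqsumD_le _ _ 1 _ _ _) _ => //.
have fin (a : \bar R) (r : R) : (0 <= a -> a < +oo -> r%:E * a < +oo)%E.
  by case: a => [a| |]//= _ _; rewrite -EFinM ltry.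
apply: lte_add_pinfty; apply: (fin); rewrite ?sqsum_ge0//.
by apply: le_lt_trans (sqsumZ_le _ _) _; apply: fin; rewrite ?sqsum_ge0.
Qed.

HB.instance Definition _ (R : realType) n :=
  GRing.isSubmodClosed.Build R[i] (seq 'I_n -> R[i]) (@square_summable R n)
    (@square_summable_submod R n).

Record fock (R : realType) (n : nat) := Fock {
  fock_fun :> seq 'I_n -> R[i];
  _ : fock_fun \in @square_summable R n
}.

HB.instance Definition _ R n := [isSub for @fock_fun R n].
HB.instance Definition _ R n := [Choice of @fock R n by <:].
HB.instance Definition _ R n :=
  [SubChoice_isSubLmodule of @fock R n by <:].

Section FockNorm.
Variables (R : realType) (n : nat).
Implicit Types (x y : fock R n).

Definition fock_norm x : R := Num.sqrt (fine (sqsum x)).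

Lemma fock_norm_ge0 x : 0 <= fock_norm x.
Proof. exact: sqrtr_ge0. Qed.

Lemma sqsum_fock x : sqsum x = (fock_norm x ^+ 2)%:E.
Proof.
have x0 := sqsum_ge0 x; rewrite /fock_norm sqr_sqrtr ?fine_ge0// fineK//.
case: x x0 => f /= /asboolP Hf f0.
by rewrite ge0_fin_numE.
Qed.

Lemma fock_norm_le x (r : R) : 0 <= r ->
  (sqsum x <= (r ^+ 2)%:E)%E -> fock_norm x <= r.
Proof.
move=> r0; rewrite sqsum_fock lee_fin => H.
by rewrite -(@ler_pXn2r _ 2)// nnegrE fock_norm_ge0.
Qed.

Lemma normc_fock_le x w : normc (x w) <= fock_norm x.
Proof.
have := sqsum_ge x w; rewrite sqsum_fock lee_fin => H.
by rewrite -(@ler_pXn2r _ 2)// nnegrE ?normc_ge0 ?fock_norm_ge0.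
Qed.

Lemma fock_ext x y : (forall w, x w = y w) -> x = y.
Proof. by move=> H; apply/val_inj/funext. Qed.

Lemma fock_combE (a : R[i]) x y w : (a *: x + y) w = a * x w + y w.
Proof. by []. Qed.

Lemma fock_norm0_eq0 x : fock_norm x = 0 -> x = 0.
Proof.
move=> x0; apply: fock_ext => w /=; apply: eq0_normc.
by apply/le_anti; rewrite normc_ge0 -x0 normc_fock_le.
Qed.

Lemma fock_normD x y : fock_norm (x + y) <= fock_norm x + fock_norm y.
Proof.
have [x0|x0] := eqVneq (fock_norm x) 0.
  by rewrite x0 (fock_norm0_eq0 x0) !add0r.
have [y0|y0] := eqVneq (fock_norm y) 0.
  by rewrite y0 (fock_norm0_eq0 y0) !addr0.
have px : 0 < fock_norm x by rewrite lt_def x0 fock_norm_ge0.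
have py : 0 < fock_norm y by rewrite lt_def y0 fock_norm_ge0.
apply: fock_norm_le; first by rewrite addr_ge0 ?fock_norm_ge0.
apply: (le_trans (@sqsumD_le _ _ (fock_norm y / fock_norm x) x y _)).
  by rewrite divr_gt0.
rewrite !sqsum_fock -!EFinM -EFinD lee_fin le_eqVlt; apply/orP; left.
by apply/eqP; field; rewrite x0 y0.
Qed.

Lemma fock_normZ_le (c : R[i]) x : fock_norm (c *: x) <= normc c * fock_norm x.
Proof.
apply: fock_norm_le; first by rewrite mulr_ge0 ?normc_ge0 ?fock_norm_ge0.
by apply: (le_trans (sqsumZ_le c x)); rewrite sqsum_fock -EFinM exprMn.
Qed.

Lemma fock_normZ (c : R[i]) x : fock_norm (c *: x) = normc c * fock_norm x.
Proof.
have [->|c0] := eqVneq c 0.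
  rewrite normc0 mul0r scale0r; apply/le_anti; rewrite fock_norm_ge0 andbT.
  by have := fock_normZ_le 0 0; rewrite scale0r normc0 mul0r.
apply/le_anti; rewrite fock_normZ_le/=.
have := fock_normZ_le c^-1 (c *: x).
rewrite scalerA mulVf// scale1r normcV -ler_pdivrMl.
  by rewrite invrK.
rewrite invr_gt0 lt_def normc_ge0 andbT.
by apply: contra c0 => /eqP/eq0_normc ->.
Qed.

Lemma fock_norm0 : fock_norm 0 = 0.
Proof. by rewrite -(scale0r 0) fock_normZ normc0 mul0r. Qed.

Let fockC x : R[i] := (fock_norm x)%:C%C.

Let fockC_D x y : fockC (x + y) <= fockC x + fockC y.
Proof. by rewrite /fockC -rmorphD lecR fock_normD. Qed.

Let fockC_Z (c : R[i]) x : fockC (c *: x) = `|c| * fockC x.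
Proof. by rewrite /fockC fock_normZ normc_abs rmorphM. Qed.

Let fockC_0 x : fockC x = 0 -> x = 0.
Proof. by move=> [] /fock_norm0_eq0. Qed.

HB.instance Definition _ :=
  @Lmodule_isNormed.Build R[i] (fock R n) fockC fockC_D fockC_Z fockC_0.

Lemma fock_normE x : `|x| = (fock_norm x)%:C%C.
Proof. by []. Qed.

End FockNorm.

Definition bounded_operator (R : realType) (n : nat) :
    {pred fock R n -> fock R n} :=
  fun T => `[< linear T /\ continuous T >].

Section BoundedOperatorClosed.
Variables (R : realType) (n : nat).
Local Notation H := (fock R n).
Implicit Types S T : H -> H.

Lemma bounded_operatorP T :
  reflect (linear T /\ continuous T) (T \in @bounded_operator R n).
Proof. exact: asboolP. Qed.

Lemma bounded_operator_submod : GRing.submod_closed (@bounded_operator R n).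
Proof.
split.
  apply/bounded_operatorP; split; first by move=> a x y; rewrite scaler0 addr0.
  exact: (@cst_continuous H H 0).
move=> a S T /bounded_operatorP[linS cS] /bounded_operatorP[linT cT].
apply/bounded_operatorP; split.
  move=> b x y; have E z : (a *: S + T) z = a *: S z + T z by [].
  by rewrite !E linS linT !scalerDr !scalerA [b * a]mulrC addrACA.
move=> x; apply: continuousD; last exact: cT.
by apply: (@continuousZl_tmp _ _ _ S); exact: cS.
Qed.

Lemma bounded_operator1 : idfun \in @bounded_operator R n.
Proof. by apply/bounded_operatorP; split=> // x; exact: cvg_id. Qed.

Lemma bounded_operatorM S T : S \in @bounded_operator R n ->
  T \in @bounded_operator R n -> S \o T \in @bounded_operator R n.
Proof.
move=> /bounded_operatorP[linS cS] /bounded_operatorP[linT cT].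
apply/bounded_operatorP; split; first by move=> b x y /=; rewrite linT linS.
by move=> x; apply: continuous_comp; [exact: cT|exact: cS].
Qed.

Lemma bounded_operator_bound T : T \in @bounded_operator R n ->
  exists2 r : R, 0 <= r & forall x, fock_norm (T x) <= r * fock_norm x.
Proof.
move=> /bounded_operatorP[linT cT].
pose T' : {linear H -> H} := HB.pack T (GRing.isLinear.Build _ _ _ _ T linT).
have /linear_bounded_continuous /linear_boundedP : continuous T' by [].
move=> /pinfty_ex_gt0[r r0 Hr].
have rE : r = (complex.Re r)%:C%C by rewrite RRe_real// gtr0_real.
exists (complex.Re r); first by rewrite -lecR -rE ltW.
by move=> x; have := Hr x; rewrite !fock_normE {1}rE -rmorphM lecR.
Qed.

Lemma bounded_operator_of_bound T (r : R) : linear T ->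
  (forall x, fock_norm (T x) <= r * fock_norm x) ->
  T \in @bounded_operator R n.
Proof.
move=> linT Hr; apply/bounded_operatorP; split => //.
pose T' : {linear H -> H} := HB.pack T (GRing.isLinear.Build _ _ _ _ T linT).
suff : continuous T' by [].
apply/linear_bounded_continuous/linear_boundedP.
near=> s; move=> x.
apply: (@le_trans _ _ (r%:C%C * `|x|)).
  by rewrite !fock_normE -rmorphM lecR Hr.
apply: ler_wpM2r => //; near: s.
by apply: nbhs_pinfty_ge; rewrite realE !lecR le_total.
Unshelve. all: by end_near. Qed.

HB.instance Definition _ := GRing.isSubmodClosed.Build R[i] (H -> H)
  (@bounded_operator R n) bounded_operator_submod.

End BoundedOperatorClosed.

Record bop (R : realType) (n : nat) := Bop {
  bop_fun :> fock R n -> fock R n;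
  _ : bop_fun \in @bounded_operator R n
}.

HB.instance Definition _ R n := [isSub for @bop_fun R n].
HB.instance Definition _ R n := [Choice of @bop R n by <:].
HB.instance Definition _ R n :=
  [SubChoice_isSubLmodule of @bop R n by <:].

Section BopAlgebra.
Variables (R : realType) (n : nat).
Implicit Types S T U : bop R n.

Lemma bop_ext S T : (forall x, S x = T x) -> S = T.
Proof. by move=> ST; apply/val_inj/funext. Qed.

Lemma bop_linear T : linear T.
Proof. by have /bounded_operatorP[] := valP T. Qed.

Lemma bop_continuous T : continuous T.
Proof. by have /bounded_operatorP[] := valP T. Qed.

HB.instance Definition _ T :=
  GRing.isLinear.Build R[i] (fock R n) (fock R n) *:%R T (@bop_linear T).

Definition bop_one : bop R n := Bop (@bounded_operator1 R n).

Definition bop_mul S T : bop R n := Bop (bounded_operatorM (valP S) (valP T)).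

Lemma bop_mulA : associative bop_mul.
Proof. by move=> S T U; exact: bop_ext. Qed.

Lemma bop_mul1 : left_id bop_one bop_mul.
Proof. by move=> S; exact: bop_ext. Qed.

Lemma bop_1mul : right_id bop_one bop_mul.
Proof. by move=> S; exact: bop_ext. Qed.

Lemma bop_mulDl : left_distributive bop_mul +%R.
Proof. by move=> S T U; exact: bop_ext. Qed.

Lemma bop_mulDr : right_distributive bop_mul +%R.
Proof. by move=> S T U; apply: bop_ext => x /=; rewrite linearD. Qed.

Definition vacuum_fun (w : seq 'I_n) : R[i] := if w == [::] then 1 else 0.

Lemma vacuum_subproof : vacuum_fun \in @square_summable R n.
Proof.
apply/square_summableP.
have -> : sqsum vacuum_fun = (\esum_(w in [set ([::] : seq (ordinal n))]) (1 : R)%:E)%E.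
  rewrite [RHS]esum_mkcond; apply: eq_esum => w _.
  rewrite classical_sets.in_set1 /vacuum_fun; case: eqVneq => _ /=.
    by rewrite !expr1n expr0n addr0 sqrtr1 expr1n.
  by rewrite !expr0n addr0 sqrtr0 expr0n.
by rewrite esum_set1 ?lee_fin// ltry.
Qed.

Definition vacuum : fock R n := Fock vacuum_subproof.

Lemma vacuum_neq0 : vacuum != 0.
Proof.
apply/eqP => /(congr1 (fun x : fock R n => x [::])) /eqP.
by rewrite /= /vacuum_fun eqxx oner_eq0.
Qed.

Lemma bop_one_neq0 : bop_one != 0.
Proof.
apply/eqP => /(congr1 (fun T : bop R n => T vacuum)) /eqP.
by rewrite /= (negbTE vacuum_neq0).
Qed.

HB.instance Definition _ := GRing.Zmodule_isNzRing.Build (bop R n)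
  bop_mulA bop_mul1 bop_1mul bop_mulDl bop_mulDr bop_one_neq0.

Lemma bop_scaleAl (a : R[i]) S T : a *: (S * T) = a *: S * T.
Proof. exact: bop_ext. Qed.

HB.instance Definition _ :=
  GRing.Lmodule_isLalgebra.Build R[i] (bop R n) bop_scaleAl.

Lemma bop_scaleAr (a : R[i]) S T : a *: (S * T) = S * (a *: T).
Proof. by apply: bop_ext => x; rewrite /= linearZ. Qed.

HB.instance Definition _ :=
  GRing.Lalgebra_isAlgebra.Build R[i] (bop R n) bop_scaleAr.

Definition opnorm T : R :=
  inf [set r : R | 0 <= r /\
                   forall x, fock_norm (T x) <= r * fock_norm x].

Let bounds T :=
  [set r : R | 0 <= r /\ forall x, fock_norm (T x) <= r * fock_norm x].

Let bounds_has_inf T : has_inf (bounds T).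
Proof.
split; last by exists 0 => r [].
by have [r r0 Hr] := bounded_operator_bound (valP T); exists r.
Qed.

Lemma opnorm_ge0 T : 0 <= opnorm T.
Proof. by apply: lb_le_inf; [exact: (bounds_has_inf T).1|move=> r []]. Qed.

Lemma opnorm_le T (r : R) : 0 <= r ->
  (forall x, fock_norm (T x) <= r * fock_norm x) -> opnorm T <= r.
Proof. by move=> r0 Hr; apply: ge_inf; [exact: (bounds_has_inf T).2|]. Qed.

Lemma opnormP T x : fock_norm (T x) <= opnorm T * fock_norm x.
Proof.
have [x0|x0] := eqVneq (fock_norm x) 0.
  by rewrite x0 mulr0 (fock_norm0_eq0 x0) linear0 fock_norm0.
have px : 0 < fock_norm x by rewrite lt_def x0 fock_norm_ge0.
rewrite -ler_pdivrMr//; apply: lb_le_inf; first exact: (bounds_has_inf T).1.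
by move=> r [_ Hr]; rewrite ler_pdivrMr.
Qed.

Lemma opnorm0_eq0 T : opnorm T = 0 -> T = 0.
Proof.
move=> T0; apply: bop_ext => x; apply: fock_norm0_eq0; apply/le_anti.
by rewrite fock_norm_ge0 andbT (le_trans (opnormP T x))// T0 mul0r.
Qed.

Lemma opnormD S T : opnorm (S + T) <= opnorm S + opnorm T.
Proof.
apply: opnorm_le => [|x]; first by rewrite addr_ge0 ?opnorm_ge0.
by rewrite (le_trans (fock_normD _ _))// mulrDl lerD ?opnormP.
Qed.

Lemma opnormM S T : opnorm (S * T) <= opnorm S * opnorm T.
Proof.
apply: opnorm_le => [|x]; first by rewrite mulr_ge0 ?opnorm_ge0.
rewrite (le_trans (opnormP S (T x)))// -mulrA.
by rewrite ler_wpM2l ?opnorm_ge0 ?opnormP.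
Qed.

Lemma opnormZ_le (a : R[i]) T : opnorm (a *: T) <= normc a * opnorm T.
Proof.
apply: opnorm_le => [|x]; first by rewrite mulr_ge0 ?opnorm_ge0 ?normc_ge0.
by rewrite fock_normZ -mulrA ler_wpM2l ?normc_ge0 ?opnormP.
Qed.

Lemma opnormZ (a : R[i]) T : opnorm (a *: T) = normc a * opnorm T.
Proof.
have [->|a0] := eqVneq a 0.
  rewrite normc0 mul0r; apply/le_anti; rewrite opnorm_ge0 andbT.
  by rewrite (le_trans (opnormZ_le _ _))// normc0 mul0r.
apply/le_anti; rewrite opnormZ_le/=.
have := opnormZ_le a^-1 (a *: T).
rewrite scalerA mulVf// scale1r normcV -ler_pdivrMl.
  by rewrite invrK.
rewrite invr_gt0 lt_def normc_ge0 andbT.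
by apply: contra a0 => /eqP/eq0_normc ->.
Qed.

Let opC T : R[i] := (opnorm T)%:C%C.

Let opC_D S T : opC (S + T) <= opC S + opC T.
Proof. by rewrite /opC -rmorphD lecR opnormD. Qed.

Let opC_Z (a : R[i]) T : opC (a *: T) = `|a| * opC T.
Proof. by rewrite /opC opnormZ normc_abs rmorphM. Qed.

Let opC_0 T : opC T = 0 -> T = 0.
Proof. by move=> [] /opnorm0_eq0. Qed.

HB.instance Definition _ :=
  @Lmodule_isNormed.Build R[i] (bop R n) opC opC_D opC_Z opC_0.

Lemma opnormE T : `|T| = (opnorm T)%:C%C.
Proof. by []. Qed.

End BopAlgebra.

Section Creation.
Variables (R : realType) (n : nat).
Implicit Types (i : 'I_n) (x : fock R n).

(* On the canonical basis, the creation operator sends e_w to e_(i w). *)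
Definition creation_fun i x (w : seq 'I_n) : R[i] :=
  if w is j :: v then (if j == i then x v else 0) else 0.

Lemma sqsum_creation i x : sqsum (creation_fun i x) = sqsum x.
Proof.
have inj : set_inj [set: seq 'I_n] (cons i) by move=> u v _ _ [].
have -> : sqsum x = (\esum_(w in [set: seq 'I_n])
    (normc (creation_fun i x (i :: w)) ^+ 2)%:E)%E.
  by apply: eq_esum => w _; rewrite /creation_fun eqxx.
rewrite -(esum_image [set: seq 'I_n] (cons i)
  (fun w => (normc (creation_fun i x w) ^+ 2)%:E) inj).
rewrite [RHS]esum_mkcond; apply: eq_esum => w _.
case: ifPn => // /negP; rewrite in_setE => Hw.
suff -> : creation_fun i x w = 0 by rewrite normc0 expr0n.
by case: w Hw => [|j v]//= Hw; case: eqVneq => // ji; case: Hw; exists v;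
  rewrite ?ji.
Qed.

Lemma creation_subproof i x : creation_fun i x \in @square_summable R n.
Proof.
apply/square_summableP; rewrite sqsum_creation; apply/square_summableP.
exact: valP x.
Qed.

Definition creation_op i x : fock R n := Fock (creation_subproof i x).

Lemma creation_bounded i : creation_op i \in @bounded_operator R n.
Proof.
apply: (@bounded_operator_of_bound _ _ _ 1) => [a x y|x].
  apply: fock_ext => w; rewrite fock_combE /= /creation_fun.
  case: w => [|j v]; first by rewrite mulr0 addr0.
  by case: ifP => _; rewrite ?fock_combE// mulr0 addr0.
by rewrite mul1r /fock_norm /= sqsum_creation.
Qed.

Definition creation i : bop R n := Bop (creation_bounded i).

End Creation.

Section ClosedKernel.
Variables (R : realType) (V : normedModType R[i]).

Lemma closed_kernel (phi : V -> R[i]) (c : R[i]) : 0 <= c ->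
  (forall S T, phi S = 0 -> `|phi T| <= c * `|T - S|) ->
  closed [set T | phi T = 0].
Proof.
move=> c0 H T clT /=; apply/eqP; apply: contraT => T0.
have c1 : 0 < c + 1 by rewrite ltr_wpDl.
have e0 : 0 < `|phi T| / (c + 1) by rewrite divr_gt0 ?normr_gt0.
have [S [/= S0]] := clT _ (nbhsx_ballx T _ e0).
rewrite -ball_normE /= ltr_pdivlMr// => TS.
have : `|phi T| < `|phi T|.
  apply: le_lt_trans (H S T S0) _; apply: le_lt_trans TS.
  by rewrite mulrC ler_wpM2l// lerDl.
by rewrite ltxx.
Qed.

End ClosedKernel.

(* The norm-closed unital algebra generated by the left creation operators. *)
Definition ncdisc_set (R : realType) (n : nat) : set (bop R n) :=
  smallest (fun S : set (bop R n) => closed S /\ GRing.subalg_closed [in S])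
           (range (@creation R n)).

Definition ncdisc_pred (R : realType) (n : nat) : {pred bop R n} :=
  [in @ncdisc_set R n].

Lemma ncdisc_subalg (R : realType) n : GRing.subalg_closed (@ncdisc_pred R n).
Proof.
split.
- by rewrite unfold_in in_setE => S /= [[_ []]]; rewrite in_setE.
- move=> a S T; rewrite !unfold_in !in_setE => HS HT U HU /=.
  have [[_ [_ + _]] _] := HU; move=> /(_ a S T); rewrite !in_setE; apply.
    exact: HS.
  exact: HT.
move=> S T; rewrite !unfold_in !in_setE => HS HT U HU /=.
have [[_ [_ _ +]] _] := HU; move=> /(_ S T); rewrite !in_setE; apply.
  exact: HS.
exact: HT.
Qed.

HB.instance Definition _ (R : realType) n :=
  GRing.isSubalgClosed.Build R[i] (bop R n) (@ncdisc_pred R n)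
    (@ncdisc_subalg R n).

Record ncdisc (R : realType) (n : nat) := NCDisc {
  ncdisc_op :> bop R n;
  _ : ncdisc_op \in @ncdisc_pred R n
}.

HB.instance Definition _ R n := [isSub for @ncdisc_op R n].
HB.instance Definition _ R n := [Choice of @ncdisc R n by <:].
HB.instance Definition _ R n :=
  [SubChoice_isSubAlgebra of @ncdisc R n by <:].

Section NCDisc.
Variables (R : realType) (n : nat).
Local Notation A := (ncdisc R n).
Implicit Types a b : A.

Lemma gen_subproof i : creation R i \in @ncdisc_pred R n.
Proof. by rewrite unfold_in in_setE => S [_]; apply; exists i. Qed.

Definition gen (i : 'I_n) : A := NCDisc (gen_subproof i).

Let anorm a : R[i] := `|ncdisc_op a|.

Let anormD a b : anorm (a + b) <= anorm a + anorm b.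
Proof. exact: ler_normD. Qed.

Let anormZ (c : R[i]) a : anorm (c *: a) = `|c| * anorm a.
Proof. exact: normrZ. Qed.

Let anorm0 a : anorm a = 0 -> a = 0.
Proof. by move=> /normr0_eq0 a0; apply/val_inj. Qed.

HB.instance Definition _ :=
  @Lmodule_isNormed.Build R[i] A anorm anormD anormZ anorm0.

Lemma ncdisc_normE a : `|a| = (opnorm a)%:C%C.
Proof. by []. Qed.

Lemma ncdisc_normM a b : `|a * b| <= `|a| * `|b|.
Proof. by rewrite !ncdisc_normE -rmorphM lecR; exact: opnormM. Qed.

End NCDisc.

Definition two_sided_ideal (A : pzRingType) (J : set A) : Prop :=
  [/\ J 0, forall x y, J x -> J y -> J (x + y)
    & forall a x b, J x -> J (a * x * b)].

Definition commutator_ideal (R : realType) (n : nat) : set (ncdisc R n) :=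
  smallest (fun J : set (ncdisc R n) => closed J /\ two_sided_ideal J)
           [set x | exists a b, x = a * b - b * a].

Section CommutatorIdeal.
Variables (R : realType) (n : nat).
Local Notation A := (ncdisc R n).
Local Notation J := (@commutator_ideal R n).
Implicit Types (a b c x y : A).

Lemma commutator_ideal_closed : closed J.
Proof. by apply: closed_bigI => I [[]]. Qed.

Lemma commutator_ideal_ideal : two_sided_ideal J.
Proof.
split.
- by move=> I /= [[_ []]].
- move=> x y Jx Jy I HI; have [[_ [_ + _]] _] := HI.
  by apply; [exact: Jx|exact: Jy].
- move=> a x b Jx I HI; have [[_ [_ _ +]] _] := HI.
  by apply; exact: Jx.
Qed.

Lemma commutator_idealD x y : J x -> J y -> J (x + y).
Proof. by have [_ + _] := commutator_ideal_ideal; apply. Qed.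

Lemma commutator_idealMl a x : J x -> J (a * x).
Proof.
by have [_ _ + Jx] := commutator_ideal_ideal => /(_ a x 1 Jx); rewrite mulr1.
Qed.

Lemma commutator_idealMr a x : J x -> J (x * a).
Proof.
by have [_ _ + Jx] := commutator_ideal_ideal => /(_ 1 x a Jx); rewrite mul1r.
Qed.

Lemma commutator_idealN x : J x -> J (- x).
Proof. by rewrite -mulN1r; exact: commutator_idealMl. Qed.

Lemma commutator_idealZ (c : R[i]) x : J x -> J (c *: x).
Proof. by rewrite -mulr_algl; exact: commutator_idealMl. Qed.

(* The vacuum state is multiplicative on A_n; its kernel is thus a closed ideal
   containing the commutators, so that the quotient by them is nonzero. *)
Lemma vacuum_stateE a (x : fock R n) :
  (ncdisc_op a x) [::] = (ncdisc_op a (vacuum R n)) [::] * x [::].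
Proof.
have : ncdisc_set (ncdisc_op a) by have := valP a; rewrite unfold_in in_setE.
move: x; pose phi (x : fock R n) (T : bop R n) : R[i] :=
  (T x) [::] - (T (vacuum R n)) [::] * x [::].
suff H : @ncdisc_set R n `<=` \bigcap_(x in [set: fock R n]) [set T | phi x T = 0].
  by move=> x /H /(_ x I) /= /eqP; rewrite subr_eq0 => /eqP.
apply: smallest_sub; last first.
  move=> _ [i _ <-] x _ /=; rewrite /phi /= mul0r subr0.
  by [].
split.
  apply: closed_bigI => x _.
  pose c := (fock_norm x + fock_norm (vacuum R n) * normc (x [::])).
  apply: (@closed_kernel _ _ (phi x) c%:C%C).
    by rewrite lecR addr_ge0 ?mulr_ge0 ?fock_norm_ge0 ?normc_ge0.
  move=> S T S0; rewrite -[phi x T]subr0 -S0.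
  have -> : phi x T - phi x S = (T - S) x [::] -
      (T - S) (vacuum R n) [::] * x [::].
    rewrite /phi; have E z : (T - S) z [::] = T z [::] - S z [::] by [].
    by rewrite !E; ring.
  rewrite (le_trans (ler_normB _ _))// normrM !normc_abs.
  rewrite opnormE -!rmorphM -rmorphD lecR /c mulrDl lerD//.
    by rewrite mulrC (le_trans (normc_fock_le _ _))// opnormP.
  rewrite -mulrA [normc _ * opnorm _]mulrC mulrA ler_wpM2r ?normc_ge0//.
  by rewrite mulrC (le_trans (normc_fock_le _ _))// opnormP.
split.
- rewrite in_setE => x _ /=; rewrite /phi /= /vacuum_fun eqxx mul1r.
  by rewrite subrr.
- move=> a0 S T; rewrite !in_setE => HS HT x _.
  suff : phi x (a0 *: S + T) = 0 by []; rewrite /phi.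
  have E z : (a0 *: S + T) z [::] = a0 * S z [::] + T z [::] by [].
  have : phi x S = 0 by exact: HS x I.
  have : phi x T = 0 by exact: HT x I.
  rewrite /phi !E => /eqP; rewrite subr_eq0 => /eqP -> /eqP.
  by rewrite subr_eq0 => /eqP ->; ring.
move=> S T; rewrite !in_setE => HS HT x _.
suff : phi x (S * T) = 0 by []; rewrite /phi.
have E z : (S * T) z = S (T z) by [].
have KS z : S z [::] = S (vacuum R n) [::] * z [::].
  by apply/eqP; rewrite -subr_eq0; apply/eqP; exact: (HS z I).
have KT z : T z [::] = T (vacuum R n) [::] * z [::].
  by apply/eqP; rewrite -subr_eq0; apply/eqP; exact: (HT z I).
by rewrite !E KS [X in _ - X * _]KS [X in _ * X - _]KT mulrA subrr.
Qed.

Lemma commutator_ideal_proper : ~ J 1.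
Proof.
pose om a : R[i] := (ncdisc_op a (vacuum R n)) [::].
have omM a b : om (a * b) = om a * om b.
  rewrite /om; have -> : ncdisc_op (a * b) (vacuum R n) =
    ncdisc_op a (ncdisc_op b (vacuum R n)) by [].
  by rewrite vacuum_stateE.
have omB a b : om (a - b) = om a - om b by [].
have omD a b : om (a + b) = om a + om b by [].
have om0 : om 0 = 0 by [].
suff H : J `<=` [set a | om a = 0].
  move=> /H /= /eqP; rewrite /om /= /vacuum_fun eqxx.
  by rewrite oner_eq0.
apply: smallest_sub; last first.
  by move=> _ [a [b ->]] /=; rewrite omB !omM mulrC subrr.
split; last first.
  split=> //= [x y|a x b]; first by rewrite omD => -> ->; rewrite addr0.
  by rewrite !omM => ->; rewrite mulr0 mul0r.
apply: (@closed_kernel _ _ om (fock_norm (vacuum R n))%:C%C).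
  by rewrite lecR fock_norm_ge0.
move=> S T S0; rewrite -[om T]subr0 -S0 -omB.
rewrite normc_abs ncdisc_normE -rmorphM lecR mulrC.
by rewrite (le_trans (normc_fock_le _ _))// opnormP.
Qed.

Definition commutator_pred : {pred A} := [in J].

Lemma commutator_predP x : reflect (J x) (x \in commutator_pred).
Proof. by apply: (iffP idP); rewrite unfold_in in_setE. Qed.

Lemma commutator_pred_zmod : GRing.zmod_closed commutator_pred.
Proof.
split.
  by apply/commutator_predP; have [] := commutator_ideal_ideal.
move=> x y /commutator_predP Jx /commutator_predP Jy; apply/commutator_predP.
by apply: commutator_idealD => //; exact: commutator_idealN.
Qed.

HB.instance Definition _ :=
  GRing.isZmodClosed.Build A commutator_pred commutator_pred_zmod.

End CommutatorIdeal.

Definition ncdisc_ab (R : realType) (n : nat) : Type :=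
  Quotient.quot (@commutator_pred R n : zmodClosed (ncdisc R n)).

HB.instance Definition _ (R : realType) n := Choice.on (ncdisc_ab R n).
HB.instance Definition _ (R : realType) n := GRing.Zmodule.on (ncdisc_ab R n).

Section Abelianization.
Variables (R : realType) (n : nat).
Local Notation A := (ncdisc R n).
Local Notation Q := (ncdisc_ab R n).
Local Notation J := (@commutator_ideal R n).
Implicit Types (a b : A) (x y z : Q).

Definition abquot a : Q :=
  \pi_(Quotient.quot (@commutator_pred R n : zmodClosed A))%qT a.

Definition abrepr x : A :=
  repr (x : Quotient.quot (@commutator_pred R n : zmodClosed A)).

Lemma abreprK x : abquot (abrepr x) = x.
Proof. exact: reprK. Qed.

Lemma abquot_eq a b : abquot a = abquot b <-> J (a - b).
Proof.
split.
  move=> /eqP ab; apply/commutator_predP.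
  by rewrite Quotient.idealrBE.
move=> /commutator_predP; rewrite Quotient.idealrBE => /eqP.
by [].
Qed.

Lemma abquot_is_zmod_morphism : zmod_morphism abquot.
Proof. by move=> a b; exact: (raddfB \pi_(Quotient.quot _)%qT). Qed.

HB.instance Definition _ :=
  GRing.isZmodMorphism.Build A Q abquot abquot_is_zmod_morphism.

Definition ab_one : Q := abquot 1.
Definition ab_mul x y : Q := abquot (abrepr x * abrepr y).
Definition ab_scale (c : R[i]) x : Q := abquot (c *: abrepr x).

Lemma abrepr_mod a : J (abrepr (abquot a) - a).
Proof. by apply/abquot_eq; rewrite abreprK. Qed.

Lemma abquotM a b : abquot (a * b) = ab_mul (abquot a) (abquot b).
Proof.
apply/esym/abquot_eq; set a' := abrepr _; set b' := abrepr _.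
have -> : a' * b' - a * b = (a' - a) * b' + a * (b' - b).
  by rewrite mulrBl mulrBr addrA subrK.
apply: commutator_idealD.
  by apply: commutator_idealMr; exact: abrepr_mod.
by apply: commutator_idealMl; exact: abrepr_mod.
Qed.

Lemma abquotZ (c : R[i]) a : abquot (c *: a) = ab_scale c (abquot a).
Proof.
apply/esym/abquot_eq; rewrite -scalerBr; apply: commutator_idealZ.
exact: abrepr_mod.
Qed.

Lemma ab_ind (P : Q -> Prop) : (forall a, P (abquot a)) -> forall x, P x.
Proof. by move=> H x; rewrite -(abreprK x). Qed.

Lemma ab_mulA : associative ab_mul.
Proof.
elim/ab_ind=> a; elim/ab_ind=> b; elim/ab_ind=> c.
by rewrite -!abquotM mulrA.
Qed.

Lemma ab_mul1 : left_id ab_one ab_mul.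
Proof. by elim/ab_ind=> a; rewrite -abquotM mul1r. Qed.

Lemma ab_1mul : right_id ab_one ab_mul.
Proof. by elim/ab_ind=> a; rewrite -abquotM mulr1. Qed.

Lemma ab_mulDl : left_distributive ab_mul +%R.
Proof.
elim/ab_ind=> a; elim/ab_ind=> b; elim/ab_ind=> c.
by rewrite -raddfD -!abquotM mulrDl raddfD.
Qed.

Lemma ab_mulDr : right_distributive ab_mul +%R.
Proof.
elim/ab_ind=> a; elim/ab_ind=> b; elim/ab_ind=> c.
by rewrite -raddfD -!abquotM mulrDr raddfD.
Qed.

Lemma ab_one_neq0 : ab_one != 0.
Proof.
apply/eqP; rewrite -(raddf0 abquot) => /abquot_eq; rewrite subr0.
exact: commutator_ideal_proper.
Qed.

HB.instance Definition _ := GRing.Zmodule_isNzRing.Build Q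
  ab_mulA ab_mul1 ab_1mul ab_mulDl ab_mulDr ab_one_neq0.

Lemma ab_scaleA (c d : R[i]) x : ab_scale c (ab_scale d x) = ab_scale (c * d) x.
Proof. by elim/ab_ind: x => a; rewrite -!abquotZ scalerA. Qed.

Lemma ab_scale1 : left_id 1 ab_scale.
Proof. by elim/ab_ind=> a; rewrite -abquotZ scale1r. Qed.

Lemma ab_scaleDr : right_distributive ab_scale +%R.
Proof.
move=> c; elim/ab_ind=> a; elim/ab_ind=> b.
by rewrite -raddfD -!abquotZ scalerDr raddfD.
Qed.

Lemma ab_scaleDl x : {morph ab_scale^~ x : c d / c + d}.
Proof. by elim/ab_ind: x => a c d; rewrite -!abquotZ scalerDl raddfD. Qed.

HB.instance Definition _ := GRing.Zmodule_isLmodule.Build R[i] Q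
  ab_scaleA ab_scale1 ab_scaleDr ab_scaleDl.

Lemma ab_scaleAl (c : R[i]) x y : c *: (x * y) = c *: x * y.
Proof.
elim/ab_ind: x => a; elim/ab_ind: y => b.
rewrite -[_ * _]/(ab_mul _ _) -[_ *: ab_mul _ _]/(ab_scale _ _).
rewrite -[RHS]/(ab_mul (ab_scale _ _) _).
by rewrite -abquotZ -!abquotM -abquotZ scalerAl.
Qed.

HB.instance Definition _ :=
  GRing.Lmodule_isLalgebra.Build R[i] Q ab_scaleAl.

Lemma ab_scaleAr (c : R[i]) x y : c *: (x * y) = x * (c *: y).
Proof.
elim/ab_ind: x => a; elim/ab_ind: y => b.
rewrite -[_ * _]/(ab_mul _ _) -[_ *: ab_mul _ _]/(ab_scale _ _).
rewrite -[RHS]/(ab_mul _ (ab_scale _ _)).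
by rewrite -abquotZ -!abquotM -abquotZ scalerAr.
Qed.

HB.instance Definition _ :=
  GRing.Lalgebra_isAlgebra.Build R[i] Q ab_scaleAr.

Lemma abquot_is_monoid_morphism : monoid_morphism abquot.
Proof. by split=> // a b; exact: abquotM. Qed.

HB.instance Definition _ :=
  GRing.isMonoidMorphism.Build A Q abquot abquot_is_monoid_morphism.

Lemma abquot_is_scalable : scalable abquot.
Proof. by move=> c a; exact: abquotZ. Qed.

HB.instance Definition _ :=
  GRing.isScalable.Build R[i] A Q *:%R abquot abquot_is_scalable.

Definition ab_norm x : R := inf [set opnorm a | a in [set a | abquot a = x]].

Let norms x := [set opnorm (ncdisc_op a) | a in [set a | abquot a = x]].

Let norms_has_inf x : has_inf (norms x).
Proof.
split; first by exists (opnorm (abrepr x)), (abrepr x) => //; exact: abreprK.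
by exists 0 => _ [a _ <-]; exact: opnorm_ge0.
Qed.

Lemma ab_norm_ge0 x : 0 <= ab_norm x.
Proof.
apply: lb_le_inf; first exact: (norms_has_inf x).1.
by move=> _ [a _ <-]; exact: opnorm_ge0.
Qed.

Lemma ab_norm_le a : ab_norm (abquot a) <= opnorm a.
Proof. by apply: ge_inf; [exact: (norms_has_inf _).2|exists a]. Qed.

Lemma ab_norm_lt x (e : R) : 0 < e ->
  exists2 a, abquot a = x & opnorm a < ab_norm x + e.
Proof.
by move=> e0; have [_ [a ax <-] H] := inf_adherent e0 (norms_has_inf x); exists a.
Qed.

Lemma ab_normD x y : ab_norm (x + y) <= ab_norm x + ab_norm y.
Proof.
apply/ler_addgt0Pr => e e0; have e2 : 0 < e / 2 by rewrite divr_gt0.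
have [a <- Ha] := ab_norm_lt x e2; have [b <- Hb] := ab_norm_lt y e2.
rewrite -raddfD (le_trans (ab_norm_le _))// (le_trans (opnormD _ _))//.
by rewrite [e]splitr addrACA ltW// ltrD.
Qed.

Lemma ab_normZ_le (c : R[i]) x : ab_norm (c *: x) <= normc c * ab_norm x.
Proof.
apply/ler_addgt0Pr => e e0.
have c1 : 0 < normc c + 1 by rewrite ltr_wpDl ?normc_ge0.
have e2 : 0 < e / (normc c + 1) by rewrite divr_gt0.
have [a ax Ha] := ab_norm_lt x e2; rewrite -{1}ax -linearZ.
rewrite (le_trans (ab_norm_le _))//.
rewrite (_ : opnorm _ = normc c * opnorm a); last exact: opnormZ.
apply: (@le_trans _ _ (normc c * (ab_norm x + e / (normc c + 1)))).
  by rewrite ler_wpM2l ?normc_ge0// ltW.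
rewrite mulrDr lerD2l mulrCA ger_pMr// ler_pdivrMr// mul1r lerDl.
exact: ler01.
Qed.

Lemma ab_normZ (c : R[i]) x : ab_norm (c *: x) = normc c * ab_norm x.
Proof.
have [->|c0] := eqVneq c 0.
  rewrite normc0 mul0r; apply/le_anti; rewrite ab_norm_ge0 andbT.
  by rewrite (le_trans (ab_normZ_le _ _))// normc0 mul0r.
apply/le_anti; rewrite ab_normZ_le/=.
have := ab_normZ_le c^-1 (c *: x).
rewrite scalerA mulVf// scale1r normcV -ler_pdivrMl.
  by rewrite invrK.
rewrite invr_gt0 lt_def normc_ge0 andbT.
by apply: contra c0 => /eqP/eq0_normc ->.
Qed.

Lemma ab_norm0_eq0 x : ab_norm x = 0 -> x = 0.
Proof.
elim/ab_ind: x => a a0; rewrite -(raddf0 abquot); apply/abquot_eq.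
rewrite subr0; apply: commutator_ideal_closed => B.
rewrite -nbhs_ballE => -[e /= e0 aB].
have eE : e = (complex.Re e)%:C%C by rewrite RRe_real// gtr0_real.
have re0 : 0 < complex.Re e by rewrite -ltcR -eE.
have [b bE Hb] := ab_norm_lt (abquot a) re0.
exists (a - b); split.
  by apply/abquot_eq; rewrite bE.
apply: aB; rewrite -ball_normE /= opprB addrCA subrr addr0.
by rewrite ncdisc_normE eE ltcR -[ltRHS]add0r -a0.
Qed.

Let abC x : R[i] := (ab_norm x)%:C%C.

Let abC_D x y : abC (x + y) <= abC x + abC y.
Proof. by rewrite /abC -rmorphD lecR ab_normD. Qed.

Let abC_Z (c : R[i]) x : abC (c *: x) = `|c| * abC x.
Proof. by rewrite /abC ab_normZ normc_abs rmorphM. Qed.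

Let abC_0 x : abC x = 0 -> x = 0.
Proof. by move=> [] /ab_norm0_eq0. Qed.

HB.instance Definition _ :=
  @Lmodule_isNormed.Build R[i] Q abC abC_D abC_Z abC_0.

Lemma ab_normE x : `|x| = (ab_norm x)%:C%C.
Proof. by []. Qed.

End Abelianization.

(* The norm of a matrix over A_n is its operator norm on the k-fold direct sum
   of the Fock space. *)
Definition column_norm (R : realType) (n k : nat) (x : 'I_k -> fock R n) : R :=
  Num.sqrt (\sum_i fock_norm (x i) ^+ 2).

Definition mx_opnorm (R : realType) (n k : nat) (M : 'M[ncdisc R n]_k) : R :=
  inf [set r : R | 0 <= r /\ forall x : 'I_k -> fock R n,
         column_norm (fun i => \sum_j ncdisc_op (M i j) (x j))
           <= r * column_norm x].

Definition completely_contractive (R : realType) (n m : nat)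
    (f : ncdisc R n -> ncdisc R m) : Prop :=
  forall (k : nat) (M : 'M[ncdisc R n]_k),
    mx_opnorm (map_mx f M) <= mx_opnorm M.

Section PointDerivations.
Variables (R : realType) (n : nat).
Implicit Types (lambda : 'rV[R[i]]_n).

Definition eucl_norm lambda : R := Num.sqrt (\sum_i normc (lambda 0 i) ^+ 2).

Definition nonzero_coord lambda : {pred 'I_n} := fun i => lambda 0 i != 0.

Definition nb_nonzero lambda : nat := #|nonzero_coord lambda|.

(* [enum_val] lists the indices of the nonzero coordinates increasingly. *)
Definition nonzero_index lambda (j : 'I_(nb_nonzero lambda)) : 'I_n :=
  enum_val j.

(* Ring morphisms of the library are unital, which excludes the zero map at
   lambda = 0; multiplicative functionals on a Banach algebra are continuous,
   so these values determine pil. *)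
Definition is_evaluation lambda (pil : {lrmorphism ncdisc R n -> R[i]^o}) :
    Prop :=
  forall i, pil (gen R i) = lambda 0 i.

Definition is_coord_projection lambda
    (Omega : {lrmorphism ncdisc R n -> ncdisc R (nb_nonzero lambda)}) : Prop :=
  [/\ completely_contractive Omega,
      forall j, Omega (gen R (nonzero_index j)) = gen R j
    & forall i, lambda 0 i = 0 -> Omega (gen R i) = 0].

Definition is_ab_evaluation lambda
    (pit : {lrmorphism ncdisc_ab R (nb_nonzero lambda) -> R[i]^o}) : Prop :=
  forall j, pit (abquot (gen R j)) = lambda 0 (nonzero_index j).

Definition point_derivation (pil D : ncdisc R n -> R[i]^o) : Prop :=
  continuous D /\ forall a b, D (a * b) = D a * pil b + pil a * D b.

Section Factorization.
Variables (m : nat) (Omega : ncdisc R n -> ncdisc R m).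
Variables (pit : ncdisc_ab R m -> R[i]^o) (D : ncdisc R n -> R[i]^o).

Definition is_factor (Dt : ncdisc_ab R m -> R[i]^o) : Prop :=
  (forall x y, Dt (x * y) = Dt x * pit y + pit x * Dt y) /\
  D = Dt \o (@abquot R m \o Omega).

Definition factors : Prop :=
  exists Dt : {linear ncdisc_ab R m -> R[i]^o}, is_factor Dt.

Definition factors_continuously : Prop :=
  exists Dt : {linear ncdisc_ab R m -> R[i]^o}, is_factor Dt /\ continuous Dt.

End Factorization.
End PointDerivations.

(* Main.v *)
Require Import Defs.
From HB Require Import structures.
From mathcomp Require Import all_boot all_order all_algebra.
From mathcomp Require Import all_classical all_reals all_analysis.
From mathcomp Require Import complex ring.
Import Order.TTheory GRing.Theory Num.Theory.
Import numFieldNormedType.Exports.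
Import ComplexField.Normc.
Local Open Scope classical_set_scope.
Local Open Scope ring_scope.

(** Why the theorem holds.

    The case |lambda| = 1. Let S be the sum of the conj(lambda_j) L_j. It is an
    isometry with value 1 at lambda, so D (S^k) = k D S while the norm of S^k
    is at most 1; hence D S = 0. For a generator L_i put
    T = L_i - lambda_i S. It has value 0 at lambda, and its range is orthogonal
    to that of S. The sum U_k of the k words S^j T S^(k-1-j) satisfies
    D U_k = k D T by the Leibniz rule, whereas these words have pairwise
    orthogonal ranges, so that the norm of U_k is at most sqrt(k) |T|
    ([opnorm_shuffle]). Letting k grow gives D T = 0, hence D L_i = 0. So D
    vanishes on the generators and, being a continuous derivation, everywhere
    ([boundary_derivation_eq0]). A nonzero D therefore forces |lambda| < 1.

    Continuity of the factorization. The map Omega has a contractive right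
    inverse ([lift_disc]). Indeed words over n letters split uniquely into a
    prefix written with the m chosen letters and a suffix that is empty or
    starts with another letter; so the Fock space on n letters is an orthogonal
    sum of copies of the Fock space on m letters ([sqsum_fibers]). An operator
    of A_m acts on all copies at once ([amplify]), with no larger norm, and this
    sends L_j to the generator of A_n for the j-th chosen letter. Every class x
    of the quotient of A_m consequently has, for every e > 0, a preimage in A_n
    of norm less than |x| + e, on which D takes the value Dt x of the given
    factor Dt. Thus Dt is bounded by the norm of D, and is itself the required
    continuous factor ([factor_continuous]). *)

Set Implicit Arguments.
Unset Strict Implicit.
Unset Printing Implicit Defensive.

(** * Density of polynomials and bounded functionals *)

Section Density.
Variables (R : realType) (n : nat).

Lemma ncdisc_set_closed : closed (@ncdisc_set R n).
Proof. by apply: closed_bigI => S [[]]. Qed.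

(** A_n has no elements beyond norm limits of polynomials in the L_i, so it
    suffices to check a norm-closed property on the operations of a unital
    algebra and on the L_i. The property need only be closed inside A_n, since
    A_n is itself closed among the bounded operators. *)
Lemma ncdisc_ind (P : set (ncdisc R n)) : closed P ->
  P 1 -> (forall (c : R[i]) a b, P a -> P b -> P (c *: a + b)) ->
  (forall a b, P a -> P b -> P (a * b)) -> (forall i, P (gen R i)) ->
  forall a, P a.
Proof.
move=> clP P1 PZD PM Pgen a.
pose S := [set T : bop R n | exists2 b, P b & ncdisc_op b = T].
suff /(_ (ncdisc_op a)) : @ncdisc_set R n `<=` S.
  have := valP a; rewrite unfold_in in_setE => Ha /(_ Ha) [b Pb ba].
  by have <- : b = a by exact/val_inj.
apply: smallest_sub; last by move=> _ [i _ <-]; exists (gen R i).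
split; last first.
  split; first by rewrite in_setE; exists 1.
    move=> c T U; rewrite !in_setE => -[b Pb <-] [d Pd <-].
    by exists (c *: b + d) => //; exact: PZD.
  move=> T U; rewrite !in_setE => -[b Pb <-] [d Pd <-].
  by exists (b * d) => //; exact: PM.
move=> T clT.
have HT : T \in @ncdisc_pred R n.
  rewrite unfold_in in_setE; apply: ncdisc_set_closed => B /clT.
  move=> [_ [[b Pb <-] Bb]]; exists (ncdisc_op b); split => //.
  by have := valP b; rewrite unfold_in in_setE.
exists (NCDisc HT) => //; apply: clP => B; rewrite -nbhs_ballE => -[e /= e0 eB].
have [_ [[b Pb <-]]] := clT _ (nbhsx_ballx T _ e0).
rewrite -ball_normE /= => Tb; exists b; split => //; apply: eB.
by rewrite -ball_normE.
Qed.

End Density.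

Section Bounded.
Variables (R : realType) (V : normedModType R[i]).

Lemma bound_of_continuous (f : {linear V -> R[i]^o}) : continuous f ->
  exists2 r : R, 0 <= r & forall x, `|f x| <= r%:C%C * `|x|.
Proof.
move=> /linear_bounded_continuous /linear_boundedP /pinfty_ex_gt0[r r0 Hr].
have rE : r = (complex.Re r)%:C%C by rewrite RRe_real// gtr0_real.
exists (complex.Re r); first by rewrite -lecR -rE ltW.
by move=> x; rewrite -rE.
Qed.

Lemma continuous_of_bound (f : {linear V -> R[i]^o}) (r : R) :
  (forall x, `|f x| <= r%:C%C * `|x|) -> continuous f.
Proof.
move=> Hr; apply/linear_bounded_continuous/linear_boundedP.
near=> s; move=> x; apply: le_trans (Hr x) _; apply: ler_wpM2r => //.
by near: s; apply: nbhs_pinfty_ge; rewrite realE !lecR le_total.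
Unshelve. all: by end_near. Qed.
End Bounded.

Lemma ncdisc_functional_bound (R : realType) n
    (D : {linear ncdisc R n -> R[i]^o}) : continuous D ->
  exists2 r : R, 0 <= r & forall a, normc (D a) <= r * opnorm a.
Proof.
move=> cD; have [r r0 Hr] := bound_of_continuous cD; exists r => // a.
have := Hr a; rewrite ncdisc_normE -rmorphM.
by rewrite -[`|D a|]/(`|D a : R[i]|) normc_abs lecR.
Qed.

(** * Amplification of operators along an inclusion of letters *)

Section Words.
Variables (m n : nat) (f : 'I_m -> 'I_n).
Hypothesis f_inj : injective f.
Implicit Types (u : seq 'I_m) (v w : seq 'I_n).

(** Every word over n letters factors uniquely as the f-image of a word over m
    letters followed by a word that is empty or starts outside the range of
    f. The next two functions compute these factors; the words v with
    [image_prefix v = [::]] are the possible second factors. *)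
Definition letter_preimage (i : 'I_n) : option 'I_m := [pick j | f j == i].

Fixpoint image_prefix w : seq 'I_m :=
  if w is i :: w' then
    if letter_preimage i is Some j then j :: image_prefix w' else [::]
  else [::].

Fixpoint image_suffix w : seq 'I_n :=
  if w is i :: w' then
    if letter_preimage i is Some _ then image_suffix w' else w
  else [::].

Lemma letter_preimageK j : letter_preimage (f j) = Some j.
Proof.
rewrite /letter_preimage; case: pickP => [k /eqP/f_inj->//|/(_ j)].
by rewrite eqxx.
Qed.

Lemma cat_prefix_suffix w : map f (image_prefix w) ++ image_suffix w = w.
Proof.
elim: w => //= i w IHw; rewrite /letter_preimage.
by case: pickP => [j /eqP <-|_] //=; rewrite IHw.
Qed.

Lemma prefix_suffix w : image_prefix (image_suffix w) = [::].
Proof.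
by elim: w => //= i w IHw; case E: (letter_preimage i) => //=; rewrite E.
Qed.

Lemma prefix_cat u v : image_prefix v = [::] -> image_prefix (map f u ++ v) = u.
Proof. by move=> v0; elim: u => //= j u IHu; rewrite letter_preimageK IHu. Qed.

Lemma suffix_cat u v : image_prefix v = [::] -> image_suffix (map f u ++ v) = v.
Proof.
move=> v0; elim: u => [|j u IHu] /=; last by rewrite letter_preimageK.
by have := cat_prefix_suffix v; rewrite v0.
Qed.

Variable R : realType.

(** The unique factorization of words splits l^2 of the n-letter monoid into an
    orthogonal sum of copies of l^2 of the m-letter monoid. *)
Lemma sqsum_fibers (h : seq 'I_n -> R[i]) :
  sqsum h = (\esum_(v in [set: seq 'I_n])
     if image_prefix v == [::] then sqsum (fun u => h (map f u ++ v)) else 0)%E.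
Proof.
pose F w : \bar R := (normc (h w) ^+ 2)%:E.
have F0 w : (0 <= F w)%E by rewrite lee_fin sqr_ge0.
pose V := [set v | image_prefix v = [::]].
have -> : (\esum_(v in [set: seq 'I_n])
     if image_prefix v == [::] then sqsum (fun u => h (map f u ++ v)) else 0)%E =
  (\esum_(v in V) \esum_(u in [set: seq 'I_m]) F (map f u ++ v))%E.
  rewrite [RHS]esum_mkcond; apply: eq_esum => v _.
  rewrite (_ : (v \in V) = (image_prefix v == [::]))//.
  by apply/idP/eqP; rewrite in_setE.
rewrite esum_esum//.
apply: (@reindex_esum _ _ _ _ _
  (fun p : seq 'I_n * seq 'I_m => map f p.2 ++ p.1)).
split=> [p _ //|[v u] [v' u']|w _].
  rewrite !in_setE /= => -[Vv _] [Vv' _] E.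
  by rewrite -(suffix_cat u Vv) -{2}(prefix_cat u Vv) E suffix_cat// prefix_cat.
exists (image_suffix w, image_prefix w) => /=; last exact: cat_prefix_suffix.
by split=> //; exact: prefix_suffix.
Qed.

Lemma sqsum_slice (x : seq 'I_n -> R[i]) v :
  (sqsum (fun u => x (map f u ++ v)) <= sqsum x)%E.
Proof.
have inj : set_inj [set: seq 'I_m] (fun u => map f u ++ v).
  move=> u u' _ _ E; have := congr1 size E; rewrite !size_cat !size_map.
  move=> /addIn sz; move/eqP: E; rewrite eqseq_cat ?size_map//.
  by move=> /andP[/eqP/(inj_map f_inj)].
rewrite {1}/sqsum.
rewrite -(esum_image _ _ (fun w => (normc (x w) ^+ 2)%:E) inj) esum_mkcond.
by apply: le_esum => w _; case: ifP => // _; rewrite lee_fin sqr_ge0.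
Qed.

Lemma slice_subproof v (x : fock R n) :
  (fun u => x (map f u ++ v)) \in @square_summable R m.
Proof.
apply/square_summableP; apply: le_lt_trans (sqsum_slice x v) _.
by apply/square_summableP; exact: valP x.
Qed.

(** When v is a second factor, this is the component of x in the copy indexed by
    v; other values of v only keep the definition total. *)
Definition slice v (x : fock R n) : fock R m := Fock (slice_subproof v x).

Lemma slice_is_linear v : linear (slice v).
Proof. by move=> c x y; exact: fock_ext. Qed.

HB.instance Definition _ v :=
  GRing.isLinear.Build R[i] (fock R n) (fock R m) *:%R (slice v)
    (@slice_is_linear v).

(** The operator T acting separately on each of these copies of l^2. *)
Definition amplify_fun (T : bop R m) (x : fock R n) w : R[i] :=
  T (slice (image_suffix w) x) (image_prefix w).

Lemma sqsum_amplify T x :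
  (sqsum (amplify_fun T x) <= (opnorm T ^+ 2)%:E * sqsum x)%E.
Proof.
rewrite (sqsum_fibers x); apply: le_trans (esum_scale_le _ _); last 2 first.
- exact: sqr_ge0.
- by move=> v; case: ifP => // _; exact: sqsum_ge0.
rewrite sqsum_fibers; apply: le_esum => v _; case: eqP => [v0|]; last first.
  by rewrite mule0.
rewrite (_ : (fun u => _) = T (slice v x)); last first.
  by apply: funext => u; rewrite /amplify_fun prefix_cat// suffix_cat.
rewrite -[X in (_ <= _ * X)%E]/(sqsum (slice v x)).
by rewrite !sqsum_fock -EFinM lee_fin -exprMn lerXn2r ?opnormP//
  nnegrE ?mulr_ge0 ?opnorm_ge0 ?fock_norm_ge0.
Qed.

Lemma amplify_subproof T x : amplify_fun T x \in @square_summable R n.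
Proof.
apply/square_summableP; apply: le_lt_trans (sqsum_amplify T x) _.
by rewrite sqsum_fock -EFinM ltry.
Qed.

Definition amplify_op T x : fock R n := Fock (amplify_subproof T x).

Lemma amplify_op_bound T x :
  fock_norm (amplify_op T x) <= opnorm T * fock_norm x.
Proof.
apply: fock_norm_le; first by rewrite mulr_ge0 ?opnorm_ge0 ?fock_norm_ge0.
by rewrite exprMn EFinM -sqsum_fock; exact: sqsum_amplify.
Qed.

Lemma amplify_bounded T : amplify_op T \in @bounded_operator R n.
Proof.
apply: (@bounded_operator_of_bound _ _ _ (opnorm T)) (amplify_op_bound T).
by move=> c x y; apply: fock_ext => w; rewrite /= /amplify_fun !linearP.
Qed.

Definition amplify T : bop R n := Bop (amplify_bounded T).

Lemma opnorm_amplify T : opnorm (amplify T) <= opnorm T.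
Proof. by apply: opnorm_le (opnorm_ge0 T) _; exact: amplify_op_bound. Qed.

Lemma amplify_is_linear : linear amplify.
Proof. by move=> c S T; apply: bop_ext => x; exact: fock_ext. Qed.

HB.instance Definition _ :=
  GRing.isLinear.Build R[i] (bop R m) (bop R n) *:%R amplify amplify_is_linear.

Lemma amplify1 : amplify 1 = 1.
Proof.
apply: bop_ext => x; apply: fock_ext => w /=.
by rewrite /amplify_fun /= cat_prefix_suffix.
Qed.

Lemma amplifyM S T : amplify (S * T) = amplify S * amplify T.
Proof.
apply: bop_ext => x; apply: fock_ext => w /=; rewrite /amplify_fun /=.
congr (bop_fun S _ _); apply: fock_ext => u /=.
by rewrite /amplify_fun prefix_cat ?suffix_cat ?prefix_suffix.
Qed.

(** Prepending the letter f j only lengthens the first factor of a word, so on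
    every copy of the small Fock space L_(f j) acts as L_j does. *)
Lemma amplify_creation j : amplify (creation R j) = creation R (f j).
Proof.
apply: bop_ext => x; apply: fock_ext => -[|i w]//=.
rewrite /amplify_fun /=; case E: (letter_preimage i) => [k|] /=.
  have <- : f k = i.
    by move: E; rewrite /letter_preimage; case: pickP => // k' /eqP <- [->].
  by rewrite (inj_eq f_inj) cat_prefix_suffix.
case: eqP => // ij.
by move: E; rewrite ij letter_preimageK.
Qed.

End Words.

(** * A contractive section of the projection onto fewer letters *)

Section Lift.
Variables (R : realType) (m n : nat) (f : 'I_m -> 'I_n).
Hypothesis f_inj : injective f.

(** Amplification is a contractive homomorphism that sends generators to
    generators, hence it cannot leave the closed algebra they generate. *)
Lemma amplify_ncdisc (b : ncdisc R m) :
  amplify f_inj (ncdisc_op b) \in @ncdisc_pred R n.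
Proof.
move: b; apply: (@ncdisc_ind _ _
  [set b | amplify f_inj (ncdisc_op b) \in @ncdisc_pred R n]) => /=.
- move=> b clb /=; rewrite unfold_in in_setE.
  apply: ncdisc_set_closed => B; rewrite -nbhs_ballE => -[e /= e0 eB].
  have [b' [/= Hb' bb']] := clb _ (nbhsx_ballx b _ e0).
  exists (amplify f_inj (ncdisc_op b')); split.
    by move: Hb'; rewrite unfold_in in_setE.
  apply: eB; move: bb'; rewrite -!ball_normE /=; apply: le_lt_trans.
  by rewrite -linearB opnormE ncdisc_normE lecR; exact: opnorm_amplify.
- by rewrite amplify1; exact: rpred1.
- by move=> c a b Ha Hb; rewrite linearP; apply: rpredD => //; exact: rpredZ.
- by move=> a b Ha Hb; rewrite amplifyM; exact: rpredM.
- by move=> j; rewrite amplify_creation; exact: gen_subproof.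
Qed.

Definition lift_disc (b : ncdisc R m) : ncdisc R n :=
  NCDisc (amplify_ncdisc b).

Lemma opnorm_lift_disc b : opnorm (lift_disc b) <= opnorm b.
Proof. exact: opnorm_amplify. Qed.

Lemma lift_disc_is_linear : linear lift_disc.
Proof. by move=> c a b; apply/val_inj; rewrite /= linearP. Qed.

HB.instance Definition _ :=
  GRing.isLinear.Build R[i] (ncdisc R m) (ncdisc R n) *:%R lift_disc
    lift_disc_is_linear.

(** Both maps are contractive homomorphisms, so the elements on which the
    composite is the identity form a closed subalgebra. *)
Lemma lift_disc_section (Omega : {lrmorphism ncdisc R n -> ncdisc R m}) :
  (forall a, opnorm (Omega a) <= opnorm a) ->
  (forall j, Omega (gen R (f j)) = gen R j) -> cancel lift_disc Omega.
Proof.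
move=> contr OmegaE.
pose defect b : R[i] := `|Omega (lift_disc b) - b|.
suff H b : defect b = 0.
  by move=> b; apply/subr0_eq/normr0_eq0; exact: H.
move: b; apply: (@ncdisc_ind _ _ [set b | defect b = 0]); rewrite /= /defect.
- apply: (@closed_kernel _ _ defect 2) => // S T /normr0_eq0/subr0_eq S0.
  rewrite /defect normr_id.
  have -> : Omega (lift_disc T) - T = Omega (lift_disc (T - S)) - (T - S).
    have -> : Omega (lift_disc (T - S)) =
        Omega (lift_disc T) - Omega (lift_disc S) by rewrite !raddfB.
    by rewrite S0 opprB addrA subrK.
  apply: le_trans (ler_normB _ _) _; rewrite [leRHS]mulr_natl mulr2n.
  apply: lerD => //.
  rewrite !ncdisc_normE lecR; apply: le_trans (contr _) _.
  exact: opnorm_lift_disc.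
- by rewrite (_ : lift_disc 1 = 1) ?rmorph1 ?subrr ?normr0//;
    apply/val_inj; exact: amplify1.
- move=> c a b /normr0_eq0/subr0_eq Ha /normr0_eq0/subr0_eq Hb.
  have -> : Omega (lift_disc (c *: a + b)) =
      c *: Omega (lift_disc a) + Omega (lift_disc b) by rewrite !linearP.
  by rewrite Ha Hb subrr normr0.
- move=> a b /normr0_eq0/subr0_eq Ha /normr0_eq0/subr0_eq Hb.
  rewrite (_ : lift_disc (a * b) = lift_disc a * lift_disc b).
    by rewrite rmorphM /= Ha Hb subrr normr0.
  by apply/val_inj; exact: amplifyM.
- move=> j; rewrite (_ : lift_disc _ = gen R (f j)) ?OmegaE ?subrr ?normr0//.
  by apply/val_inj; exact: amplify_creation.
Qed.
End Lift.

(** The case of 1 x 1 matrices. *)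
Lemma completely_contractive_contractive (R : realType) (m n : nat)
    (f : ncdisc R n -> ncdisc R m) : completely_contractive f ->
  forall a, opnorm (f a) <= opnorm a.
Proof.
have mx1 k (a : ncdisc R k) :
    mx_opnorm (const_mx a : 'M[ncdisc R k]_1) = opnorm a.
  rewrite /mx_opnorm /opnorm; congr inf; apply: funext => r /=.
  have colE (x : 'I_1 -> fock R k) : column_norm x = fock_norm (x ord0).
    by rewrite /column_norm big_ord1 sqrtr_sqr ger0_norm ?fock_norm_ge0.
  apply/propext; split=> -[r0 H]; split=> // x.
    by have := H (fun=> x); rewrite !colE big_ord1 mxE.
  by rewrite !colE big_ord1 mxE; exact: H.
move=> ccf a; have := ccf 1%N (const_mx a).
by rewrite map_const_mx !mx1.
Qed.

(** * Rows of creation operators *)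

Section Rows.
Variables (R : realType) (n : nat).

Definition creation_row (c : 'I_n -> R[i]) : ncdisc R n :=
  \sum_j c j *: gen R j.

(** Distinct letters create into orthogonal subspaces. *)
Lemma sqsum_creations (y : 'I_n -> fock R n) :
  sqsum (\sum_j creation R j (y j)) = (\sum_j sqsum (y j))%E.
Proof.
transitivity (\sum_j sqsum (creation_fun j (y j)))%E; last first.
  by apply: eq_bigr => j _; exact: sqsum_creation.
rewrite -esum_sum; last by move=> *; rewrite lee_fin sqr_ge0.
apply: eq_esum => w _.
have -> : (\sum_j creation R j (y j)) w = \sum_j creation_fun j (y j) w.
  by elim/big_ind2: _ => // x1 x2 a b <- <-.
have F0 : (normc (0 : R[i]) ^+ 2)%:E = 0%E by rewrite normc0 expr0n.
case: w => [|i w].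
  by rewrite [X in normc X]big1// F0 big1// => j _; rewrite F0.
rewrite (bigD1 i)//= [in RHS](bigD1 i)//= eqxx.
rewrite [X in _ + X]big1 ?addr0 ?[X in (_ + X)%E]big1 ?adde0// => j;
  by rewrite eq_sym => /negPf ->.
Qed.

Lemma normc_sqrE (z : R[i]) : ((normc z ^+ 2)%:C)%C = z * z^*.
Proof. by rewrite rmorphXn /= -normc_abs normCK. Qed.

(** Pythagoras in C^n for the orthogonal vectors a c and b d. *)
Lemma pythagoras_coord (c d : 'I_n -> R[i]) (a b : R[i]) :
  \sum_j c j * (d j)^* = 0 ->
  \sum_j normc (c j * a + d j * b) ^+ 2 =
  (\sum_j normc (c j) ^+ 2) * normc a ^+ 2 +
  (\sum_j normc (d j) ^+ 2) * normc b ^+ 2.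
Proof.
move=> orth; apply: (@complexI R).
have sumC (z : 'I_n -> R[i]) :
    ((\sum_j normc (z j) ^+ 2)%:C)%C = \sum_j z j * (z j)^*.
  by rewrite rmorph_sum; apply: eq_bigr => j _; exact: normc_sqrE.
have -> : forall s t u v : R,
    ((s * t + u * v)%:C)%C = (s%:C * t%:C + u%:C * v%:C)%C.
  by move=> *; rewrite rmorphD !rmorphM.
rewrite !sumC !normc_sqrE.
rewrite !mulr_suml -big_split /=.
have orth' : \sum_j (c j)^* * d j = 0.
  rewrite -[LHS]conjCK rmorph_sum /=.
  under eq_bigr do rewrite rmorphM /= conjCK.
  by rewrite orth rmorph0.
apply/eqP; rewrite -subr_eq0 -sumrB; apply/eqP.
transitivity (\sum_j (c j * (d j)^*) * (a * b^*) +
              \sum_j ((c j)^* * d j) * (a^* * b)); last first.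
  by rewrite -!mulr_suml orth orth' !mul0r addr0.
rewrite -big_split /=; apply: eq_bigr => j _.
by rewrite rmorphD !rmorphM /=; ring.
Qed.

Lemma creation_rowE c (x : fock R n) :
  ncdisc_op (creation_row c) x = \sum_j creation R j (c j *: x).
Proof.
rewrite /creation_row; transitivity (\sum_j ncdisc_op (c j *: gen R j) x).
  by elim/big_ind2: _ => // a1 x1 a2 x2 <- <-.
by apply: eq_bigr => j _; rewrite linearZ.
Qed.

(** For orthogonal coefficient vectors the two rows have orthogonal ranges, so
    no cross term appears; the row with coefficients c is |c| times an
    isometry. *)
Lemma pythagoras_row c d (y z : fock R n) :
  \sum_j c j * (d j)^* = 0 ->
  fock_norm (ncdisc_op (creation_row c) y +
             ncdisc_op (creation_row d) z) ^+ 2 <=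
  (\sum_j normc (c j) ^+ 2) * fock_norm y ^+ 2 +
  (\sum_j normc (d j) ^+ 2) * fock_norm z ^+ 2.
Proof.
move=> orth; rewrite -lee_fin -sqsum_fock !creation_rowE -big_split /=.
have -> : \sum_j (creation R j (c j *: y) + creation R j (d j *: z)) =
    \sum_j creation R j (c j *: y + d j *: z).
  by apply: eq_bigr => j _; rewrite linearD.
rewrite sqsum_creations -esum_sum; last by move=> *; rewrite lee_fin sqr_ge0.
rewrite EFinD [X in (X + _)%E]EFinM [X in (_ + X)%E]EFinM -!sqsum_fock.
have s0 (e : 'I_n -> R[i]) : 0 <= \sum_j normc (e j) ^+ 2.
  by apply: sumr_ge0 => j _; exact: sqr_ge0.
apply: le_trans (leeD (esum_scale_le (s0 c) _) (esum_scale_le (s0 d) _));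
  last 2 first.
- by move=> w; rewrite lee_fin sqr_ge0.
- by move=> w; rewrite lee_fin sqr_ge0.
rewrite -esumD; last 2 first.
- by move=> w _; rewrite mule_ge0 ?lee_fin ?s0 ?sqr_ge0.
- by move=> w _; rewrite mule_ge0 ?lee_fin ?s0 ?sqr_ge0.
apply: le_esum => w _; rewrite sumEFin -!EFinM -EFinD lee_fin.
by rewrite -pythagoras_coord.
Qed.

Lemma creation_row_contractive c (x : fock R n) :
  \sum_j normc (c j) ^+ 2 = 1 ->
  fock_norm (ncdisc_op (creation_row c) x) <= fock_norm x.
Proof.
move=> c1; rewrite -(@ler_pXn2r _ 2)// ?nnegrE ?fock_norm_ge0//.
have := @pythagoras_row c (fun=> 0) x x.
rewrite (_ : creation_row (fun=> 0) = 0); last first.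
  by rewrite /creation_row big1// => j _; rewrite scale0r.
rewrite addr0 c1 mul1r [X in _ + X * _]big1 ?mul0r ?addr0; last first.
  by move=> j _; rewrite normc0 expr0n.
by apply; rewrite big1// => j _; rewrite conjC0 mulr0.
Qed.

(** This is the sum of the words S^j T S^(k-1-j) over j < k. The recursion
    groups them by their leftmost letter, because what follows S and what
    follows T are sent into orthogonal ranges when S and T are orthogonal
    rows. *)
Fixpoint shuffle (S T : ncdisc R n) k : ncdisc R n :=
  if k is k'.+1 then S * shuffle S T k' + T * S ^+ k' else 0.

Lemma creation_row_pow_contractive c k (x : fock R n) :
  \sum_j normc (c j) ^+ 2 = 1 ->
  fock_norm (ncdisc_op (creation_row c ^+ k) x) <= fock_norm x.
Proof.
move=> c1; elim: k => // k IHk; rewrite exprS.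
exact: le_trans (creation_row_contractive _ c1) IHk.
Qed.

(** The recursive definition writes the sum of k+1 words as
    S U + T S^k with U the sum of k words. As S and T have orthogonal ranges,
    the squared norms add, and each step contributes at most the squared norm
    of T. The norm thus grows only like the square root of k. *)
Lemma opnorm_shuffle c d k :
  \sum_j normc (c j) ^+ 2 = 1 -> \sum_j c j * (d j)^* = 0 ->
  opnorm (shuffle (creation_row c) (creation_row d) k) ^+ 2 <=
    k%:R * \sum_j normc (d j) ^+ 2.
Proof.
move=> c1 orth; set t := \sum_j _.
have t0 : 0 <= t by apply: sumr_ge0 => j _; exact: sqr_ge0.
have H x :
    fock_norm (ncdisc_op (shuffle (creation_row c) (creation_row d) k) x) ^+ 2
    <= k%:R * t * fock_norm x ^+ 2.
  elim: k => [|k IHk].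
    rewrite (_ : ncdisc_op (shuffle _ _ _) x = 0)//.
    by rewrite fock_norm0 expr0n !mul0r.
  apply: le_trans (pythagoras_row _ _ orth) _.
  rewrite c1 mul1r -natr1 2!mulrDl mul1r lerD//.
  rewrite ler_wpM2l// lerXn2r ?nnegrE ?fock_norm_ge0//.
  exact: creation_row_pow_contractive.
have kt0 : 0 <= k%:R * t by rewrite mulr_ge0.
rewrite -[leRHS]sqr_sqrtr// lerXn2r ?nnegrE ?opnorm_ge0 ?sqrtr_ge0//.
apply: opnorm_le => [|x]; first exact: sqrtr_ge0.
rewrite -(@ler_pXn2r _ 2)// ?nnegrE ?mulr_ge0 ?fock_norm_ge0 ?sqrtr_ge0//.
by rewrite exprMn (sqr_sqrtr kt0) H.
Qed.

End Rows.

(** * Point derivations at the boundary of the ball *)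

Lemma sqr_linear_growth (R : realType) (y C : R) :
  (forall k, (k.+1%:R * y) ^+ 2 <= k.+1%:R * C) -> y = 0.
Proof.
move=> H; apply/eqP; apply: contraT => y0.
have y2 : 0 < y ^+ 2 by rewrite exprn_even_gt0.
have C0 : 0 <= C.
  by have := H 0%N; rewrite !mul1r; apply: le_trans; exact: sqr_ge0.
have Cy0 : 0 <= C / y ^+ 2 by rewrite divr_ge0// ltW.
have := archi_boundP Cy0; set k := Num.bound _ => ky.
have ky1 : C / y ^+ 2 < k.+1%:R by apply: lt_le_trans ky _; rewrite ler_nat.
have := H k; rewrite exprMn expr2 -mulrA ler_pM2l// -ler_pdivlMr//.
by rewrite leNgt ky1.
Qed.

Section Boundary.
Variables (R : realType) (n : nat) (lambda : 'rV[R[i]]_n).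
Variables (pil : {lrmorphism ncdisc R n -> R[i]^o}).
Variables (D : {linear ncdisc R n -> R[i]^o}).
Hypothesis pilE : is_evaluation lambda pil.
Hypothesis D_der : point_derivation pil D.
Hypothesis lambda1 : eucl_norm lambda = 1.

Let D_leibniz a b : D (a * b) = D a * pil b + pil a * D b.
Proof. exact: D_der.2. Qed.

Lemma derivation1 : D 1 = 0.
Proof.
have := D_leibniz 1 1; rewrite mulr1 rmorph1 mulr1 mul1r => /eqP.
by rewrite -subr_eq0 opprD addrA subrr sub0r oppr_eq0 => /eqP.
Qed.

Lemma derivation_pow S k : pil S = 1 -> D (S ^+ k) = k%:R * D S.
Proof.
move=> S1; elim: k => [|k IHk]; first by rewrite expr0 derivation1 mul0r.
by rewrite exprS D_leibniz IHk S1 rmorphXn /= S1 expr1n mulr1 mul1r -nat1r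
  mulrDl mul1r.
Qed.

(** When S has value 1 and T has value 0, each of the k words contributes
    D T: differentiating a letter S leaves the factor T of value 0. *)
Lemma derivation_shuffle S T k : pil S = 1 -> pil T = 0 ->
  D (shuffle S T k) = k%:R * D T.
Proof.
move=> S1 T0; have pil0 j : pil (shuffle S T j) = 0.
  elim: j => [|j IHj] /=; first exact: rmorph0.
  by rewrite rmorphD !rmorphM /= IHj T0 mulr0 mul0r addr0.
elim: k => [|k IHk] /=; first by rewrite linear0 mul0r.
rewrite linearD !D_leibniz IHk S1 T0 rmorphXn /= S1 expr1n pil0.
by rewrite mulr0 add0r mul1r mulr1 mul0r addr0 -natr1 mulrDl mul1r.
Qed.

(** Linear growth of D along elements whose norms grow at most like the square
    root of k would contradict the boundedness of D. *)
Lemma derivation_eq0_of_growth (U : nat -> ncdisc R n) a (t : R) :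
  (forall k, D (U k) = k%:R * D a) ->
  (forall k, opnorm (U k.+1) ^+ 2 <= k.+1%:R * t) -> D a = 0.
Proof.
move=> DU Ut; have [r r0 Hr] := ncdisc_functional_bound D_der.1.
apply/eq0_normc/(@sqr_linear_growth _ _ (r ^+ 2 * t)) => k.
have -> : k.+1%:R * normc (D a) = normc (D (U k.+1)).
  rewrite DU normcM; congr (_ * _).
  by apply: (@complexI R); rewrite -normc_abs normr_nat rmorph_nat.
apply: (@le_trans _ _ ((r * opnorm (U k.+1)) ^+ 2)).
  by rewrite lerXn2r ?nnegrE ?normc_ge0 ?mulr_ge0 ?opnorm_ge0.
by rewrite exprMn [leRHS]mulrCA ler_wpM2l// sqr_ge0.
Qed.

(* The row S with these coefficients has norm |lambda| = 1, the value it takes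
   at lambda: it plays the role of a peak function at lambda. *)
Let c j := (lambda 0 j)^*.
Let S := creation_row c.

Lemma sum_conj_mul : \sum_j c j * lambda 0 j = 1.
Proof.
have : \sum_j normc (lambda 0 j) ^+ 2 = 1.
  have s0 : 0 <= \sum_j normc (lambda 0 j) ^+ 2.
    by apply: sumr_ge0 => j _; exact: sqr_ge0.
  by rewrite -(sqr_sqrtr s0) -/(eucl_norm lambda) lambda1 expr1n.
move=> /(congr1 (real_complex R)); rewrite rmorph1 => <-.
rewrite rmorph_sum; apply: eq_bigr => j _.
by rewrite mulrC; apply/esym; exact: normc_sqrE.
Qed.

Lemma sum_normc_conj : \sum_j normc (c j) ^+ 2 = 1.
Proof.
apply: (@complexI R); rewrite rmorph1 -sum_conj_mul.
rewrite rmorph_sum; apply: eq_bigr => j _.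
by rewrite [LHS]normc_sqrE /c conjCK.
Qed.

Lemma pil_creation_row (d : 'I_n -> R[i]) :
  pil (creation_row d) = \sum_j d j * lambda 0 j.
Proof.
rewrite linear_sum; apply: eq_bigr => j _.
by rewrite linearZ /= pilE.
Qed.

(** Powers of S stay bounded while D (S^k) = k D S, which forces D S = 0; the
    sums of shuffled words handle the directions orthogonal to S. *)
Lemma boundary_derivation_eq0 a : D a = 0.
Proof.
have S1 : pil S = 1 by rewrite pil_creation_row sum_conj_mul.
have DS : D S = 0.
  apply: (@derivation_eq0_of_growth (fun k => S ^+ k) S 1).
    by move=> k; exact: derivation_pow.
  move=> k; rewrite mulr1; apply: (@le_trans _ _ 1); last by rewrite ler1n.
  rewrite -[leRHS](expr1n _ 2) lerXn2r ?nnegrE ?opnorm_ge0//.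
  apply: opnorm_le => // x; rewrite mul1r.
  by apply: creation_row_pow_contractive; exact: sum_normc_conj.
have Dgen i : D (gen R i) = 0.
  (* Subtracting lambda_i S from L_i makes the value at lambda vanish, which is
     also what makes the coefficient vector orthogonal to that of S. *)
  pose d j := (i == j)%:R - lambda 0 i * c j.
  have TE : creation_row d = gen R i - lambda 0 i *: S.
    rewrite /creation_row /d.
    under eq_bigr do rewrite scalerBl -scalerA.
    rewrite sumrB -scaler_sumr (bigD1 i)//= eqxx scale1r big1 ?addr0// => j.
    by rewrite eq_sym => /negPf ->; rewrite scale0r.
  have T0 : pil (creation_row d) = 0.
    by rewrite TE linearB linearZ /= pilE S1 [_ *: _]mulr1 subrr.
  have orth : \sum_j c j * (d j)^* = 0.
    under eq_bigr => j _.
      rewrite /d rmorphB rmorphM /= conjC_nat conjCK mulrBr mulrCA.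
      over.
    rewrite sumrB -mulr_sumr sum_conj_mul mulr1.
    rewrite (bigD1 i)//= eqxx mulr1 big1 ?addr0 ?subrr// => j.
    by rewrite eq_sym => /negPf ->; rewrite mulr0.
  have : D (creation_row d) = 0.
    apply: derivation_eq0_of_growth (fun k => derivation_shuffle k S1 T0) _.
    by move=> k; apply: opnorm_shuffle => //; exact: sum_normc_conj.
  by rewrite TE linearB linearZ /= DS scaler0 subr0.
move: a; apply: (@ncdisc_ind _ _ [set a | D a = 0]) => /=.
- have [r r0 Hr] := bound_of_continuous D_der.1.
  apply: (@closed_kernel _ _ D r%:C%C) => [|U T U0]; first by rewrite lecR.
  by rewrite -[D T]subr0 -U0 -linearB.
- exact: derivation1.
- by move=> b U T U0 T0; rewrite linearP U0 T0 scaler0 addr0.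
- by move=> U T U0 T0; rewrite D_leibniz U0 T0 mulr0 mul0r addr0.
- exact: Dgen.
Qed.
End Boundary.

(** * Continuous factorization *)

(** The factor Dt inherits continuity from D, because every element of the
    quotient lifts to the domain of D without essential growth of the norm. *)
Lemma factor_continuous (R : realType) (m n : nat) (f : 'I_m -> 'I_n)
    (Omega : {lrmorphism ncdisc R n -> ncdisc R m})
    (D : {linear ncdisc R n -> R[i]^o}) (Dt : {linear ncdisc_ab R m -> R[i]^o}) :
  injective f -> (forall a, opnorm (Omega a) <= opnorm a) ->
  (forall j, Omega (gen R (f j)) = gen R j) ->
  continuous D -> (D : ncdisc R n -> R[i]^o) = Dt \o (@abquot R m \o Omega) ->
  continuous Dt.
Proof.
move=> f_inj contr OmegaE cD DE; have [r r0 Hr] := ncdisc_functional_bound cD.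
apply: (@continuous_of_bound _ _ Dt r) => x.
rewrite ab_normE -rmorphM -[`|Dt x|]/(`|Dt x : R[i]|) normc_abs lecR.
apply/ler_addgt0Pr => e e0.
have r1 : 0 < r + 1 by rewrite ltr_wpDl.
have e1 : 0 < e / (r + 1) by rewrite divr_gt0.
have [b bx Hb] := ab_norm_lt x e1.
have -> : Dt x = D (lift_disc f_inj b).
  by rewrite DE /= (lift_disc_section f_inj contr OmegaE) bx.
apply: le_trans (Hr _) _.
apply: (@le_trans _ _ (r * (ab_norm x + e / (r + 1)))).
  by rewrite ler_wpM2l// (le_trans (opnorm_lift_disc f_inj b))// ltW.
rewrite mulrDr lerD2l mulrCA ger_pMr// ler_pdivrMr// mul1r lerDl.
exact: ler01.
Qed.

Theorem theorem5p8 (R : realType) (n : nat) (lambda : 'rV[R[i]]_n)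
    (pil : {lrmorphism ncdisc R n -> R[i]^o})
    (Omega : {lrmorphism ncdisc R n -> ncdisc R (nb_nonzero lambda)})
    (pit : {lrmorphism ncdisc_ab R (nb_nonzero lambda) -> R[i]^o})
    (D : {linear ncdisc R n -> R[i]^o}) :
  (1 <= n)%N ->
  eucl_norm lambda <= 1 ->
  is_evaluation lambda pil ->
  is_coord_projection Omega ->
  is_ab_evaluation pit ->
  point_derivation pil D ->
  (exists a, D a <> 0) ->
  factors Omega pit D ->
  eucl_norm lambda < 1 /\ factors_continuously Omega pit D.
Proof.
move=> _ le1 pilE [cc_Omega Omega_gen _] _ D_der [a Da] [Dt DtF]; split.
  rewrite lt_neqAle le1 andbT; apply/eqP => l1.
  by apply: Da; exact: (boundary_derivation_eq0 pilE D_der l1).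
exists Dt; split=> //.
apply: (factor_continuous (f := @nonzero_index _ _ lambda) _ _ Omega_gen
  D_der.1 DtF.2).
  exact: enum_val_inj.
exact: completely_contractive_contractive.
Qed.
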